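(* Let $A\in R(\Omega)$, with associated sequences $(a_n),(b_n),(c_n),(d_n)$, let $\alpha\in\mathbb N$, let $x'\in\Omega$ be a point beginning with the word $0^\alpha1$, and suppose that the involution kernel $W$ of $A$ based at $x'$ exists. Then for all $k,l\in\mathbb N$ (where $y=[u]$ or $x=[u]$ means that the sequence $y_1y_2\dots$, respectively $x_1x_2\dots$, begins with the finite word $u$): - if $y=[0^l1]$ and $x=[0^k1]$, then $W(y|x)=\sum_{j=1}^l(a_{j+k}-a_{j+\alpha})+d_{l+k}-d_{l+\alpha}$; - if $y=[0^l1]$ and $x=[1^k0]$, then $W(y|x)=b_k-a_{\alpha+1}+\sum_{j=2}^l(a_j-a_{j+\alpha})+d_l-d_{l+\alpha}$; - if $y=[1^l0]$ and $x=[0^k1]$, then $W(y|x)=d_k-d_\alpha$; - if $y=[1^l0]$ and $x=[1^k0]$, then $W(y|x)=c_{k+1}-d_\alpha+\sum_{j=2}^l(c_{k+j}-c_j)+(b_{k+l}-b_l)$.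
   Context: $\mathbb N=\{1,2,\dots\}$, $\Omega=\{0,1\}^{\mathbb N}$ with the product topology. $\Omega^-$ is a copy of $\Omega$ whose points are written $y=(y_1,y_2,\dots)$; $\hat\Omega=\Omega^-\times\Omega$, with points $(y|x)=(\dots,y_2,y_1|x_1,x_2,\dots)$. The Walters family $R(\Omega)$ is the set of continuous $A:\Omega\to\mathbb R$ for which there are convergent real sequences $(a_n),(b_n),(c_n),(d_n)$ such that for all $n\in\mathbb N$, $w\in\Omega$: $A(0^{n+1}1w)=a_{n+1}$, $A(01^n0w)=b_n$, $A(1^{n+1}0w)=c_{n+1}$, $A(10^n1w)=d_n$. The involution kernel of $A$ based at $x'\in\Omega$ is $W(y|x)=\sum_{n\ge1}[A(y_n,\dots,y_1,x_1,x_2,\dots)-A(y_n,\dots,y_1,x'_1,x'_2,\dots)]$; it exists if this series converges for every $(y|x)\in\hat\Omega$. *)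

(* Defs.v *)
From HB Require Import structures.
From mathcomp Require Import all_boot all_order all_algebra.
From mathcomp Require Import all_classical all_reals all_analysis.

Set Implicit Arguments.
Unset Strict Implicit.
Unset Printing Implicit Defensive.
Import Order.TTheory GRing.Theory Num.Theory.
Import numFieldNormedType.Exports.
Local Open Scope classical_set_scope.
Local Open Scope ring_scope.

(* The letters 0 and 1 are [false] and [true].  Coordinates are numbered from
   0, so the paper's x_n (n >= 1) is [x n.-1]. *)
Definition Omega := cantor_space.

Definition Omega_minus := Omega.

(* The point (y|x) is the pair (y, x). *)
Definition Omega_hat : Type := (Omega_minus * Omega)%type.

Definition word_cat (u : seq bool) (w : Omega) : Omega :=
  fun i : nat => if (i < size u)%N then nth false u i else w (i - size u)%N.

(* x = [u]. *)
Definition begins_with (x : Omega) (u : seq bool) : Prop :=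
  forall i : nat, (i < size u)%N -> x i = nth false u i.

(* The words 0^n 1 and 1^n 0. *)
Definition word01 (n : nat) : seq bool := rcons (nseq n false) true.
Definition word10 (n : nat) : seq bool := rcons (nseq n true) false.

(* Here the sequences are indexed as in the paper, by n >= 1; their entries
   at index 0 (and those of [a] and [c] at index 1) are unconstrained. *)
Definition walters_sequences (R : realType) (A : Omega -> R)
    (a b c d : nat -> R) : Prop :=
  [/\ cvgn a, cvgn b, cvgn c & cvgn d] /\
  forall (n : nat) (w : Omega), (0 < n)%N ->
    [/\ A (word_cat (word01 n.+1) w) = a n.+1,
        A (word_cat (false :: word10 n) w) = b n,
        A (word_cat (word10 n.+1) w) = c n.+1
      & A (word_cat (true :: word01 n) w) = d n].

Definition walters_family (R : realType) : set (Omega -> R) :=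
  [set A | continuous A /\
     exists a b c d : nat -> R, walters_sequences A a b c d].

(* The word y_n ... y_1. *)
Definition past_word (y : Omega_minus) (n : nat) : seq bool := rev (mkseq y n).

(* The general term of the involution kernel; index n is the paper's n + 1. *)
Definition kernel_term (R : realType) (A : Omega -> R) (x' : Omega)
    (p : Omega_hat) (n : nat) : R :=
  A (word_cat (past_word p.1 n.+1) p.2) - A (word_cat (past_word p.1 n.+1) x').

Definition involution_kernel_exists (R : realType) (A : Omega -> R)
    (x' : Omega) : Prop :=
  forall p : Omega_hat, cvgn (series (kernel_term A x' p)).

Definition involution_kernel (R : realType) (A : Omega -> R) (x' : Omega)
    (p : Omega_hat) : R :=
  limn (series (kernel_term A x' p)).

(* Main.v *)
(* The value A z depends only on the first run of z and, when that run has
   length 1, on the second one.  If y begins with e^l (~e), then for n > l + 1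
   the word y_n ... y_1 already displays these runs, so the n-th term of W is
   zero and W is a finite sum that is read off term by term. *)
Require Import Defs.
From HB Require Import structures.
From mathcomp Require Import all_boot all_order all_algebra.
From mathcomp Require Import all_classical all_reals all_analysis.
Import Order.TTheory GRing.Theory Num.Theory.
Import numFieldNormedType.Exports.
Local Open Scope classical_set_scope.
Local Open Scope ring_scope.

Set Implicit Arguments.
Unset Strict Implicit.

Lemma word_catA (u v : seq bool) (w : Omega) :
  word_cat u (word_cat v w) = word_cat (u ++ v) w.
Proof.
apply/funext => i; rewrite /word_cat size_cat nth_cat.
case: (ltnP i (size u)) => [iu|ui]; first by rewrite ltn_addr.
by rewrite ltn_subLR // subnDA.
Qed.

Lemma begins_withP (x : Omega) (u : seq bool) :
  begins_with x u -> exists w, x = word_cat u w.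
Proof.
move=> xu; exists (fun i => x (i + size u)%N).
apply/funext => i; rewrite /word_cat; case: ltnP => [/xu //|ui].
by rewrite subnK.
Qed.

Lemma split_first_run (f : bool) (s : seq bool) :
  ~~ f \in s -> exists m t, s = nseq m f ++ ~~ f :: t.
Proof.
elim: s => // h s IH; rewrite inE.
case: (eqVneq (~~ f) h) => [<- _|nfh /= /IH[m [t ->]]].
  by exists 0%N, s.
exists m.+1, t => /=; congr cons; by case: f h nfh {IH} => [] [].
Qed.

(** The partial sums are constant from index [N] on. *)
Lemma limn_series_finite (R : realType) (u : nat -> R) (N : nat) :
  (forall n, (N <= n)%N -> u n = 0) ->
  limn (series u) = \sum_(0 <= n < N) u n.
Proof.
move=> u0; apply/(cvg_lim (@Rhausdorff R)).
apply: (@cvg_near_cst _ _ _ _ _ _).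
exists N => // n /= Nn; rewrite /series /= (big_cat_nat (n := N)) //=.
rewrite [X in _ + X]big_nat_cond [X in _ + X]big1 ?addr0 //.
move=> i /andP[/andP[Ni _] _].
exact: u0.
Qed.

Section WaltersSequences.
Variables (R : realType) (A : Omega -> R) (a b c d : nat -> R).
Hypothesis hA : walters_sequences A a b c d.

(** This and the next three lemmas let an arbitrary word [t] follow the letter that closes the
    deciding run, which is the shape produced by merging nested [word_cat]s. *)
Lemma walters_aE n t w : (0 < n)%N ->
  A (word_cat (nseq n.+1 false ++ true :: t) w) = a n.+1.
Proof.
move=> n0; rewrite -cat_rcons -word_catA.
by have [-> _ _ _] := hA.2 n (word_cat t w) n0.
Qed.

Lemma walters_bE n t w : (0 < n)%N ->
  A (word_cat (false :: nseq n true ++ false :: t) w) = b n.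
Proof.
move=> n0; rewrite -cat_rcons -cat_cons -word_catA.
by have [_ -> _ _] := hA.2 n (word_cat t w) n0.
Qed.

Lemma walters_cE n t w : (0 < n)%N ->
  A (word_cat (nseq n.+1 true ++ false :: t) w) = c n.+1.
Proof.
move=> n0; rewrite -cat_rcons -word_catA.
by have [_ _ -> _] := hA.2 n (word_cat t w) n0.
Qed.

Lemma walters_dE n t w : (0 < n)%N ->
  A (word_cat (true :: nseq n false ++ true :: t) w) = d n.
Proof.
move=> n0; rewrite -cat_rcons -cat_cons -word_catA.
by have [_ _ _ ->] := hA.2 n (word_cat t w) n0.
Qed.

Lemma walters_determined (f : bool) (s : seq bool) (w w' : Omega) :
  true \in s -> false \in s ->
  A (word_cat (f :: s) w) = A (word_cat (f :: s) w').
Proof.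
move=> s1 s0.
have [|m [t sE]] := @split_first_run f s; first by case: f.
(* If [m = 0], the first run is the single letter [f]; the occurrence of [f] in [s] then lies in [t]
   and closes the second run, so the value is a [b] or a [d]. Otherwise the first run has length at
   least 2 and is closed inside [s], which gives an [a] or a [c]. *)
rewrite {}sE in s1 s0 *; case: m s1 s0 => [|m] s1 s0.
  have [|m' [t' ->]] := @split_first_run (~~ f) t.
    by case: f s1 s0 => /=; rewrite !inE.
  case: f {s1 s0}; first by rewrite !(walters_dE (n := m'.+1)).
  by rewrite !(walters_bE (n := m'.+1)).
case: f {s1 s0}; first by rewrite !(walters_cE (n := m.+1)).
by rewrite !(walters_aE (n := m.+1)).
Qed.

Lemma involution_kernel_first_run (e : bool) (l : nat) (x' x y : Omega) :
  (0 < l)%N -> begins_with y (rcons (nseq l e) (~~ e)) ->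
  involution_kernel A x' (y, x) =
    \sum_(0 <= n < l)
       (A (word_cat (nseq n.+1 e) x) - A (word_cat (nseq n.+1 e) x'))
    + (A (word_cat (~~ e :: nseq l e) x) - A (word_cat (~~ e :: nseq l e) x')).
Proof.
move=> l0 yE.
have ye i : (i < l)%N -> y i = e.
  move=> il; rewrite yE ?size_rcons ?size_nseq ?ltnS 1?ltnW //.
  by rewrite nth_rcons size_nseq il nth_nseq il.
have yl : y l = ~~ e.
  by rewrite yE ?size_rcons ?size_nseq // nth_rcons size_nseq ltnn eqxx.
have past n : (n <= l)%N -> past_word y n = nseq n e.
  elim: n => // n IH nl; rewrite /past_word /mkseq -addn1 iotaD map_cat rev_cat.
  by rewrite /= -/(mkseq y n) -/(past_word y n) IH 1?ltnW // ye // addn1.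
have pastS n : past_word y n.+1 = y n :: past_word y n.
  by rewrite /past_word -addn1 /mkseq iotaD map_cat rev_cat.
(* The term of index [n] sees [y 0] to [y n], so index [l] is the first to see [~~ e], and the last
   at which the past can leave a deciding run open. *)
rewrite /involution_kernel (limn_series_finite (N := l.+1)).
  rewrite big_nat_recr //= /kernel_term /= pastS yl past //; congr (_ + _).
  by apply: eq_big_nat => n /andP[_ nl]; rewrite past.
move=> n ln; rewrite /kernel_term /= pastS; apply/eqP; rewrite subr_eq0.
apply/eqP.
(* Since [n > l], both [y 0 = e] and [y l = ~~ e] stand behind the head letter [y n], as
   [walters_determined] requires. *)
have mem i : (i < n)%N -> y i \in past_word y n.
  by move=> in_; rewrite mem_rev map_f // mem_iota.
have e_past : e \in past_word y n by rewrite -(ye 0%N l0) mem ?(leq_trans _ ln).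
have ne_past : ~~ e \in past_word y n by rewrite -yl mem.
by case: (e) e_past ne_past => ? ?; apply: walters_determined.
Qed.

End WaltersSequences.

Unset Implicit Arguments.
Set Strict Implicit.

Theorem mainTheorem4 (R : realType) (A : Omega -> R) (a b c d : nat -> R)
  (alpha : nat) (x' : Omega)
  (hA : walters_family A)
  (hseq : walters_sequences A a b c d)
  (halpha : (0 < alpha)%N)
  (hx' : begins_with x' (word01 alpha))
  (hW : involution_kernel_exists A x') :
  let W := involution_kernel A x' in
  forall (k l : nat) (y : Omega_minus) (x : Omega),
    (0 < k)%N -> (0 < l)%N ->
    [/\ begins_with y (word01 l) -> begins_with x (word01 k) ->
          W (y, x) = \sum_(1 <= j < l.+1) (a (j + k)%N - a (j + alpha)%N)
                     + d (l + k)%N - d (l + alpha)%N,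
        begins_with y (word01 l) -> begins_with x (word10 k) ->
          W (y, x) = b k - a alpha.+1
                     + \sum_(2 <= j < l.+1) (a j - a (j + alpha)%N)
                     + d l - d (l + alpha)%N,
        begins_with y (word10 l) -> begins_with x (word01 k) ->
          W (y, x) = d k - d alpha
      & begins_with y (word10 l) -> begins_with x (word10 k) ->
          W (y, x) = c k.+1 - d alpha
                     + \sum_(2 <= j < l.+1) (c (k + j)%N - c j)
                     + (b (k + l)%N - b l)].
Proof.
move=> W k l y x k0 l0; rewrite {}/W.
have [w' {hx'}->] := begins_withP hx'.
split=> yl /begins_withP[w ->];
  rewrite (involution_kernel_first_run hseq _ _ l0 yl);
  rewrite /word01 /word10 -!cats1 !word_catA /=.
(* The zeros of [y] merge with the initial zeros of [x] and of [x'], so run lengths add in every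
   term. *)
- rewrite !catA -!nseqD !(walters_dE hseq) ?addn_gt0 ?l0 // addrA big_add1.
  congr (_ + _ - _); apply: eq_big_nat => n _.
  rewrite !word_catA !catA -!(nseqD n.+1) !addSn.
  by rewrite !(walters_aE hseq) // addn_gt0 ?k0 ?halpha orbT.
(* The successor form of [k] exposes the leading 1 of [x], which closes each run of zeros. The term
   of index 0 is split off: there the run before [x] has length 1, so the second run decides and
   gives [b]. *)
- case: k k0 => // k k0; case: l l0 yl => // l l0 _.
  rewrite [_ ++ nseq alpha _ ++ _]catA -nseqD !(walters_dE hseq) //.
  rewrite big_nat_recl // addrA !big_add1 /=.
  rewrite !word_catA (walters_bE (n := k.+1) hseq) //.
  rewrite (walters_aE (n := alpha) hseq) //.
  congr (_ + _ + _ - _).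
  apply: eq_big_nat => n _.
  rewrite !word_catA [_ ++ nseq alpha _ ++ _]catA -(nseqD n.+2).
  rewrite (walters_aE (n := n.+1) hseq) //.
  by rewrite (walters_aE (n := (n.+1 + alpha)%N) hseq).
- case: k k0 => // k k0; case: alpha halpha => // al al0.
  case: l l0 yl => // l l0 _.
  (* Both [x] and [x'] start with 0 and close the run of ones: the last term is [b - b] with equal
     indices, those of index 1 and above are [c - c], and only index 0 survives. *)
  rewrite !(walters_bE hseq) // subrr addr0 big_nat_recl //.
  rewrite !word_catA (walters_dE (n := k.+1) hseq) //.
  rewrite (walters_dE (n := al.+1) hseq) // big1 ?addr0 // => n _.
  by rewrite !word_catA !(walters_cE (n := n.+1) hseq) // subrr.
(* Here the ones of [y] merge with those of [x], while the leading 0 of [x'] closes the run; at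
   index 0 this gives [c k.+1] against [d alpha]. *)
- case: alpha halpha => // al al0; case: l l0 yl => // l l0 _.
  rewrite [_ ++ nseq k _ ++ _]catA -nseqD !(walters_bE hseq) //.
  rewrite big_nat_recl // !big_add1 /=.
  rewrite !word_catA (walters_cE (n := k) hseq) //.
  rewrite (walters_dE (n := al.+1) hseq) //.
  rewrite (addnC k); congr (_ + _ + _).
  apply: eq_big_nat => n _.
  rewrite !word_catA [_ ++ nseq k _ ++ _]catA -(nseqD n.+2).
  rewrite (walters_cE (n := (n.+1 + k)%N) hseq) //.
  rewrite (walters_cE (n := n.+1) hseq) //.
  by rewrite (addnC k).
Qed.
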